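(* Let $\{(\theta_t,r_t,m_t)\}_{t\ge 0}$ be generated by AEGDM (defined in the context) with step size $\eta>0$, momentum parameter $\mu$, and objective functions $\{f_t\}_{t\ge 0}$. Then AEGDM is unconditionally energy stable in the sense that, for any step size $\eta>0$ and each $i\in\{1,\dots,n\}$, $r_{t,i}$ is strictly decreasing in $t$ and convergent, with $r_{t,i}\to r_i^*$ as $t\to\infty$. Moreover: (i) for any $0\le \mu<1$ and $\eta>0$, $$\lim_{t\to\infty}\|\theta_{t+1}-\theta_t\|=0,\qquad \sum_{t=0}^\infty\|\theta_{t+1}-\theta_t\|^2\le \frac{2\eta n}{(1-\mu)^2}\,(f_0(\theta_0)+c);$$ (ii) for any $\eta>0$, every integer $T\ge1$ and every $i\in\{1,\dots,n\}$, $$\frac1T\sum_{t=0}^{T-1}|v_{t,i}|\le \left(\frac{\sqrt{f_0(\theta_0)+c}}{2}\right)^{1/2}\frac{1}{\sqrt{\eta\,T\,r_{T,i}}}.$$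
   Context: Let $f_t:\mathbb{R}^n\to\mathbb{R}$, $t=0,1,2,\dots$, be differentiable functions and $c$ a constant such that $f_t(\theta)+c>0$ for all $t$ and all $\theta\in\mathbb{R}^n$. Let $\theta_0\in\mathbb{R}^n$. $\|\cdot\|$ is the Euclidean norm and $\partial_i$ is the $i$-th partial derivative. AEGDM with step size $\eta$ and momentum parameter $\mu$ is the iteration, for $t\ge 0$ and $i\in\{1,\dots,n\}$, $$v_{t,i}=\frac{\partial_i f_t(\theta_t)}{2\sqrt{f_t(\theta_t)+c}},\qquad m_{t+1,i}=\mu m_{t,i}+v_{t,i},\quad m_{0,i}=0,$$ $$r_{t+1,i}=\frac{r_{t,i}}{1+2\eta v_{t,i}^2},\quad r_{0,i}=\sqrt{f_0(\theta_0)+c},\qquad \theta_{t+1,i}=\theta_{t,i}-2\eta\, r_{t+1,i}m_{t+1,i}.$$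
   Formalization: ''Strictly decreasing'' fails when v_{t,i}=0 (e.g. constant f_t keep r_{t,i} constant); the formal claim is that r_{t,i} is nonincreasing in t, with r_{t+1,i}<r_{t,i} at every step where v_{t,i} is nonzero. *)

(* Defs.v *)
From HB Require Import structures.
From mathcomp Require Import all_boot all_order all_algebra.
From mathcomp Require Import all_classical all_reals all_analysis.

Set Implicit Arguments.
Unset Strict Implicit.
Unset Printing Implicit Defensive.

Import Order.TTheory GRing.Theory Num.Theory.
Import numFieldNormedType.Exports.

Local Open Scope classical_set_scope.
Local Open Scope ring_scope.

(* The norm `|x| on 'rV[R]_n in the library is the sup norm, hence this one. *)
Definition enorm (R : realType) (n : nat) (x : 'rV[R]_n) : R :=
  Num.sqrt (\sum_(i < n) x 0 i ^+ 2).

Definition partial (R : realType) (n : nat) (f : 'rV[R]_n -> R) (i : 'I_n)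
    (x : 'rV[R]_n) : R :=
  'D_(delta_mx 0 i) f x.

Definition aegdm_v (R : realType) (n : nat) (f : nat -> 'rV[R]_n -> R) (c : R)
    (theta : nat -> 'rV[R]_n) (t : nat) (i : 'I_n) : R :=
  partial (f t) i (theta t) / (2 * Num.sqrt (f t (theta t) + c)).

Record aegdm (R : realType) (n : nat) (f : nat -> 'rV[R]_n -> R) (c : R)
    (theta0 : 'rV[R]_n) (eta mu : R) (theta r m : nat -> 'rV[R]_n) : Prop := {
  aegdm_theta0 : theta 0%N = theta0 ;
  aegdm_m0 : forall i, m 0%N 0 i = 0 ;
  aegdm_r0 : forall i, r 0%N 0 i = Num.sqrt (f 0%N theta0 + c) ;
  aegdm_mS : forall t i, m t.+1 0 i = mu * m t 0 i + aegdm_v f c theta t i ;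
  aegdm_rS : forall t i,
    r t.+1 0 i = r t 0 i / (1 + 2 * eta * aegdm_v f c theta t i ^+ 2) ;
  aegdm_thetaS : forall t i,
    theta t.+1 0 i = theta t 0 i - 2 * eta * r t.+1 0 i * m t.+1 0 i
}.

(* A step with v_{t,i} = 0 leaves r_{t,i} unchanged, so "r_{t,i} is strictly
   decreasing in t" can only be meant at the steps where v_{t,i} != 0. *)
Lemma aegdm_r_stall (R : realType) (n : nat) (f : nat -> 'rV[R]_n -> R) (c : R)
    (theta0 : 'rV[R]_n) (eta mu : R) (theta r m : nat -> 'rV[R]_n)
    (t : nat) (i : 'I_n) :
  aegdm f c theta0 eta mu theta r m -> aegdm_v f c theta t i = 0 ->
  r t.+1 0 i = r t 0 i.
Proof. by move=> /aegdm_rS -> ->; rewrite expr0n mulr0 addr0 divr1. Qed.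

(* Main.v *)
Require Import Defs.
From HB Require Import structures.
From mathcomp Require Import all_boot all_order all_algebra.
From mathcomp Require Import all_classical all_reals all_analysis.
From mathcomp Require Import ring lra.

Set Implicit Arguments.
Unset Strict Implicit.
Unset Printing Implicit Defensive.

Import Order.TTheory GRing.Theory Num.Theory.
Import numFieldNormedType.Exports.

Local Open Scope classical_set_scope.
Local Open Scope ring_scope.

(** Everything rests on the identity
    r_t - r_{t+1} = 2 eta r_{t+1} v_t^2 (aegdm_r_drop), which holds in
    each coordinate separately. As r_t stays positive, r_t decreases to a
    limit for every step size, and the drops sum to at most r_0.

    For the mean of |v_t|: since r_T is the smallest factor, the telescoped
    identity gives 2 eta r_T sum_{t<T} v_t^2 <= r_0, and
    Cauchy-Schwarz turns this l^2 bound into a bound on the mean of |v_t|.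

    For the steps of theta: m_{t+1} is the convex combination of m_t and
    v_t / (1 - mu) with weights mu and 1 - mu, so its square is
    controlled by m_t^2 and v_t^2, and the v_t^2 part is paid for by the drop
    of r_t. This is summarized by the modified energy
    E_t = r_t + 2 eta mu (1 - mu) r_t m_t^2, which loses at least
    2 eta (1 - mu)^2 r_{t+1} m_{t+1}^2 at each step
    (aegdm_energy_step), while E_0 = r_0. As the step of theta squares to
    4 eta^2 r_{t+1}^2 m_{t+1}^2 <= 4 eta^2 r_0 (r_{t+1} m_{t+1}^2), summing
    over t gives 2 eta r_0^2 / (1 - mu)^2 in each coordinate, where
    r_0^2 = f_0(theta_0) + c. The steps are then square summable, hence tend to
    zero. *)

(** Cauchy-Schwarz against the constant sequence 1, in the form of the
    nonnegativity of the empirical variance. *)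
Lemma sqr_sum_le (R : realFieldType) (T : nat) (a : nat -> R) :
  (\sum_(0 <= t < T) a t) ^+ 2 <= T%:R * \sum_(0 <= t < T) a t ^+ 2.
Proof.
have sqr_dev s : 0 <= \sum_(0 <= t < T) a t ^+ 2
    - 2 * s * (\sum_(0 <= t < T) a t) + T%:R * s ^+ 2.
  (* The right-hand side expands the squared deviations of a from s. *)
  rewrite [leRHS](_ : _ = \sum_(0 <= t < T) (a t - s) ^+ 2).
    by apply: sumr_ge0 => t _; exact: sqr_ge0.
  elim: T => [|T IHT]; first by rewrite !big_geq// mulr0 mul0r subr0 addr0.
  by rewrite !big_nat_recr//= -IHT -natr1; ring.
case: (posnP T) => [->|T_gt0]; first by rewrite !big_geq// expr0n mul0r.
have TR_gt0 : 0 < T%:R :> R by rewrite ltr0n.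
(* The mean of a is the s that gives the sharpest inequality. *)
have := sqr_dev ((\sum_(0 <= t < T) a t) / T%:R).
set A := \sum_(0 <= t < T) a t; set Q := \sum_(0 <= t < T) _ => dev.
suff : 0 <= T%:R * Q - A ^+ 2 by rewrite subr_ge0.
have := mulr_ge0 (ltW TR_gt0) dev.
by congr (_ <= _); field; rewrite gt_eqF.
Qed.

Lemma nneseries_le_cvg0 (R : realType) (a : nat -> R) (K : R) :
    (forall t, 0 <= a t) -> (forall T, \sum_(0 <= t < T) a t <= K) ->
  a t @[t --> \oo] --> 0 /\ (\sum_(0 <= t <oo) (a t)%:E <= K%:E)%E.
Proof.
move=> a_ge0 a_le; split.
  apply: cvg_series_cvg_0; apply: nondecreasing_is_cvgn.
    by apply/nondecreasing_seqP => T; rewrite /series/= big_nat_recr//= lerDl.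
  by exists K => _ [T _ <-]; exact: a_le.
apply: lime_le.
  by apply: is_cvg_nneseries => t _ _; rewrite lee_fin.
by apply: nearW => T; rewrite sumEFin lee_fin.
Qed.

Section Energy.
Variables (R : realType) (n : nat) (f : nat -> 'rV[R]_n -> R) (c : R).
Variables (theta0 : 'rV[R]_n) (eta mu : R) (theta r m : nat -> 'rV[R]_n).
Hypotheses (fc_gt0 : 0 < f 0 theta0 + c) (eta_gt0 : 0 < eta).
Hypothesis gen : aegdm f c theta0 eta mu theta r m.
Variable i : 'I_n.

Let r_ := fun t => r t 0 i.
Let m_ := fun t => m t 0 i.
Let v_ := fun t => aegdm_v f c theta t i.

Let eta_ge0 : 0 <= eta.
Proof. exact: ltW. Qed.

Let factor_gt0 t : 0 < 1 + 2 * eta * v_ t ^+ 2.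
Proof.
by rewrite ltr_wpDr// mulr_ge0 ?sqr_ge0// mulr_ge0// ltW.
Qed.

Lemma aegdm_r_gt0 t : 0 < r_ t.
Proof.
elim: t => [|t IHt]; first by rewrite /r_ (aegdm_r0 gen) sqrtr_gt0.
by rewrite /r_ (aegdm_rS gen) divr_gt0// factor_gt0.
Qed.

Let aegdm_r_ge0 t : 0 <= r_ t.
Proof. exact: ltW (aegdm_r_gt0 t). Qed.

(** The energy identity: multiply the update rule of r by its denominator. *)
Lemma aegdm_r_drop t : r_ t - r_ t.+1 = 2 * eta * r_ t.+1 * v_ t ^+ 2.
Proof.
have rE : r_ t = r_ t.+1 * (1 + 2 * eta * v_ t ^+ 2).
  by rewrite [r_ t.+1](aegdm_rS gen) divfK// gt_eqF// factor_gt0.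
by rewrite rE; ring.
Qed.

Lemma aegdm_r_nonincreasing : nonincreasing_seq r_.
Proof.
apply/nonincreasing_seqP => t; rewrite -subr_ge0 aegdm_r_drop.
by rewrite !(sqr_ge0, mulr_ge0) ?aegdm_r_ge0 ?eta_ge0.
Qed.

Lemma aegdm_r_decreasing t : v_ t != 0 -> r_ t.+1 < r_ t.
Proof.
move=> v_neq0; rewrite -subr_gt0 aegdm_r_drop.
by rewrite pmulr_rgt0 ?exprn_even_gt0// !mulr_gt0// aegdm_r_gt0.
Qed.

Lemma aegdm_r_cvg : cvgn r_.
Proof.
apply: nonincreasing_is_cvgn; first exact: aegdm_r_nonincreasing.
by exists 0 => _ [t _ <-]; exact: ltW (aegdm_r_gt0 t).
Qed.

(** The drops of r telescope, and r_T bounds every r_{t+1} from below. *)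
Lemma aegdm_sum_v T :
  2 * eta * r_ T * (\sum_(0 <= t < T) v_ t ^+ 2) <= r_ 0%N.
Proof.
suff le_drop : 2 * eta * r_ T * (\sum_(0 <= t < T) v_ t ^+ 2)
    <= \sum_(0 <= t < T) (r_ t - r_ t.+1).
  apply: le_trans le_drop _.
  under eq_bigr do rewrite -opprB.
  rewrite sumrN telescope_sumr// opprB.
  by rewrite gerBl ltW// aegdm_r_gt0.
rewrite mulr_sumr; apply: ler_sum_nat => t /andP[_ t_lt].
rewrite aegdm_r_drop ler_wpM2r ?sqr_ge0// ler_wpM2l ?mulr_ge0//.
exact: aegdm_r_nonincreasing.
Qed.

Lemma aegdm_mean_v T : (1 <= T)%N ->
  T%:R^-1 * \sum_(0 <= t < T) `|v_ t|
    <= Num.sqrt (r_ 0%N / 2) * (Num.sqrt (eta * T%:R * r_ T))^-1.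
Proof.
move=> T_ge1.
have T_gt0 : 0 < T%:R :> R by rewrite ltr0n.
have rT_gt0 := aegdm_r_gt0 T.
have r0_gt0 := aegdm_r_gt0 0.
have den_gt0 : 0 < eta * T%:R * r_ T by rewrite !mulr_gt0.
set A := \sum_(0 <= t < T) `|v_ t|.
have A_ge0 : 0 <= A by exact: sumr_ge0.
rewrite -(sqrtrV (ltW den_gt0)) -sqrtrM; last by rewrite divr_ge0// ltW.
have mean_ge0 : 0 <= T%:R^-1 * A by rewrite mulr_ge0 ?invr_ge0.
rewrite -(ger0_norm mean_ge0) -sqrtr_sqr ler_wsqrtr//.
rewrite ler_pdivlMr// exprMn.
have := sqr_sum_le T (fun t => `|v_ t|); rewrite -/A.
under [in X in _ <= X -> _]eq_bigr do rewrite real_normK ?num_real//.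
move: (aegdm_sum_v T); set Q := \sum_(0 <= t < T) _ => Q_le A_le.
rewrite [leLHS](_ : _ = eta * r_ T * (A ^+ 2 / T%:R)); last first.
  by field; rewrite gt_eqF.
have AQ : A ^+ 2 / T%:R <= Q by rewrite ler_pdivrMr// mulrC.
apply: (@le_trans _ _ (eta * r_ T * Q)); last by lra.
by rewrite ler_wpM2l// mulr_ge0// ltW.
Qed.

(** The extra term of the energy is what the momentum carries over from
    step t: after the convexity bound for m_{t+1}^2, the coefficients of
    r_{t+1} m_{t+1}^2 on the left add up to 2 eta (1 - mu), and those of m_t^2
    and v_t^2 match the momentum term and the drop of r. *)
Lemma aegdm_energy_step t : 0 <= mu < 1 ->
  r_ t.+1 + 2 * eta * mu * (1 - mu) * (r_ t.+1 * m_ t.+1 ^+ 2)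
    + 2 * eta * (1 - mu) ^+ 2 * (r_ t.+1 * m_ t.+1 ^+ 2)
    <= r_ t + 2 * eta * mu * (1 - mu) * (r_ t * m_ t ^+ 2).
Proof.
move=> /andP[mu_ge0 mu_lt1].
have mSE : m_ t.+1 = mu * m_ t + v_ t := aegdm_mS gen t i.
have r_le : r_ t.+1 <= r_ t by exact: aegdm_r_nonincreasing.
(* Jensen for the square, multiplied by 1 - mu; the gap between the two sides
   is mu ((1 - mu) m_t - v_t)^2. *)
have convex : (1 - mu) * m_ t.+1 ^+ 2
    <= mu * (1 - mu) * m_ t ^+ 2 + v_ t ^+ 2.
  have : 0 <= mu * ((1 - mu) * m_ t - v_ t) ^+ 2 by rewrite mulr_ge0 ?sqr_ge0.
  by rewrite mSE; lra.
have conv2 : 2 * eta * r_ t.+1 * ((1 - mu) * m_ t.+1 ^+ 2)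
    <= 2 * eta * r_ t.+1 * (mu * (1 - mu) * m_ t ^+ 2 + v_ t ^+ 2).
  by rewrite ler_wpM2l// !mulr_ge0 ?aegdm_r_ge0.
have rm_le : 2 * eta * (mu * (1 - mu) * m_ t ^+ 2) * r_ t.+1
    <= 2 * eta * (mu * (1 - mu) * m_ t ^+ 2) * r_ t.
  by rewrite ler_wpM2l// !(sqr_ge0, mulr_ge0) ?subr_ge0// ltW.
have := aegdm_r_drop t.
lra.
Qed.

(** Summed energy decay; the initial energy is r_0 because m_0 = 0. *)
Lemma aegdm_sum_rm T : 0 <= mu < 1 ->
  2 * eta * (1 - mu) ^+ 2 * (\sum_(0 <= t < T) r_ t.+1 * m_ t.+1 ^+ 2)
    <= r_ 0%N.
Proof.
move=> mu01; have /andP[mu_ge0 mu_lt1] := mu01.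
suff : 2 * eta * (1 - mu) ^+ 2 * (\sum_(0 <= t < T) r_ t.+1 * m_ t.+1 ^+ 2)
    + (r_ T + 2 * eta * mu * (1 - mu) * (r_ T * m_ T ^+ 2)) <= r_ 0%N.
  apply: le_trans; rewrite lerDl addr_ge0 ?aegdm_r_ge0//.
  by rewrite !(sqr_ge0, mulr_ge0) ?aegdm_r_ge0 ?subr_ge0// ltW.
elim: T => [|T IHT].
  by rewrite big_geq// /m_ (aegdm_m0 gen) expr0n !mulr0 add0r addr0.
rewrite big_nat_recr//= mulrDr.
by have := aegdm_energy_step T mu01; lra.
Qed.

(** One of the two factors r_{t+1} in the squared step is bounded by r_0; the
    other is kept for the summed energy decay. *)
Lemma aegdm_sum_coord T : 0 <= mu < 1 ->
  \sum_(0 <= t < T) (theta t.+1 - theta t) 0 i ^+ 2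
    <= 2 * eta / (1 - mu) ^+ 2 * (f 0 theta0 + c).
Proof.
move=> mu01; have /andP[mu_ge0 mu_lt1] := mu01.
have r0E : f 0 theta0 + c = r_ 0%N ^+ 2.
  by rewrite /r_ (aegdm_r0 gen) sqr_sqrtr// ltW.
have q_gt0 : 0 < (1 - mu) ^+ 2 by rewrite exprn_gt0// subr_gt0.
have r0_gt0 := aegdm_r_gt0 0.
apply: (@le_trans _ _ (4 * eta ^+ 2 * r_ 0%N *
    \sum_(0 <= t < T) r_ t.+1 * m_ t.+1 ^+ 2)).
  rewrite mulr_sumr; apply: ler_sum_nat => t _.
  rewrite !mxE (aegdm_thetaS gen) -/(r_ _) -/(m_ _).
  rewrite (_ : _ ^+ 2 =
    4 * eta ^+ 2 * r_ t.+1 * (r_ t.+1 * m_ t.+1 ^+ 2)); last by ring.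
  rewrite ler_wpM2r ?(sqr_ge0, mulr_ge0) ?aegdm_r_ge0//.
  rewrite ler_wpM2l ?(sqr_ge0, mulr_ge0)//.
  exact: aegdm_r_nonincreasing.
rewrite r0E (_ : _ / _ * _ = 2 * eta * r_ 0%N * r_ 0%N / (1 - mu) ^+ 2);
  last by field; rewrite gt_eqF// subr_gt0.
rewrite ler_pdivlMr//.
have := aegdm_sum_rm T mu01; set S := \sum_(0 <= t < T) _ => S_le.
have : 0 <= 2 * eta * r_ 0%N by rewrite !mulr_ge0// ltW.
by move=> /ler_wpM2l/(_ _ _ S_le); lra.
Qed.

End Energy.

Theorem theorem4p1 (R : realType) (n : nat) (f : nat -> 'rV[R]_n -> R) (c : R)
    (f_diff : forall t x, differentiable (f t) x)
    (fc_gt0 : forall t x, 0 < f t x + c)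
    (theta0 : 'rV[R]_n) (eta mu : R) (eta_gt0 : 0 < eta)
    (theta r m : nat -> 'rV[R]_n)
    (gen : aegdm f c theta0 eta mu theta r m) :
  [/\ forall i : 'I_n,
        [/\ nonincreasing_seq (fun t => r t 0 i),
            forall t, aegdm_v f c theta t i != 0 -> r t.+1 0 i < r t 0 i &
            exists r_star : R, r t 0 i @[t --> \oo] --> r_star],
      0 <= mu < 1 ->
        enorm (theta t.+1 - theta t) @[t --> \oo] --> (0 : R) /\
        (\sum_(0 <= t <oo) (enorm (theta t.+1 - theta t) ^+ 2)%:E
           <= (2 * eta * n%:R / (1 - mu) ^+ 2 * (f 0%N theta0 + c))%:E)%E &
      forall (T : nat) (i : 'I_n), (1 <= T)%N ->
        T%:R^-1 * \sum_(0 <= t < T) `|aegdm_v f c theta t i|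
          <= (Num.sqrt (f 0%N theta0 + c) / 2) `^ 2^-1
             * (Num.sqrt (eta * T%:R * r T 0 i))^-1].
Proof.
have fc0 := fc_gt0 0%N theta0.
have enorm_sqr x : enorm x ^+ 2 = \sum_(i < n) x 0 i ^+ 2 :> R.
  by rewrite sqr_sqrtr// sumr_ge0// => i _; exact: sqr_ge0.
split.
- move=> i; split.
  + exact: aegdm_r_nonincreasing fc0 eta_gt0 gen i.
  + move=> t; exact: aegdm_r_decreasing fc0 eta_gt0 gen i t.
  + exists (limn (fun t => r t 0 i)).
    exact: aegdm_r_cvg fc0 eta_gt0 gen i.
- move=> mu01.
  have [] := @nneseries_le_cvg0 R (fun t => enorm (theta t.+1 - theta t) ^+ 2)
    (2 * eta * n%:R / (1 - mu) ^+ 2 * (f 0%N theta0 + c)).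
  + by move=> t; exact: sqr_ge0.
  + move=> T; under eq_bigr do rewrite enorm_sqr.
    rewrite exchange_big/=.
    apply: le_trans (ler_sum _ (fun i _ =>
      aegdm_sum_coord fc0 eta_gt0 gen i T mu01)) _.
    rewrite sumr_const card_ord -mulr_natr le_eqVlt.
    by apply/orP; left; apply/eqP; ring.
  + move=> sq_cvg0 sum_le; split=> //.
    rewrite (_ : (fun t => _) =
      (fun t => Num.sqrt (enorm (theta t.+1 - theta t) ^+ 2))); last first.
      by apply/funext => t; rewrite sqrtr_sqr ger0_norm// sqrtr_ge0.
    rewrite -[0 in X in _ --> X]sqrtr0.
    exact: cvg_comp sq_cvg0 (@sqrt_continuous R 0).
- move=> T i T_ge1; rewrite powR12_sqrt; last by rewrite divr_ge0// sqrtr_ge0.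
  by rewrite -(aegdm_r0 gen i); exact: aegdm_mean_v fc0 eta_gt0 gen i T T_ge1.
Qed.
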